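(* Let $\mathcal{A}_1,\mathcal{A}_2$ be disjoint finite sets of agents and $\mathcal{B}_1,\mathcal{B}_2$ disjoint finite sets of tasks (no agent is a task), with $|\mathcal{A}_1|\ge|\mathcal{B}_1|\geq 1$ and $|\mathcal{A}_2|\ge|\mathcal{B}_2|\geq 1$. Put $\mathcal{A}_3=\mathcal{A}_1\cup\mathcal{A}_2$, $\mathcal{B}_3=\mathcal{B}_1\cup\mathcal{B}_2$, and for $k\in\{1,2,3\}$ let $\mathcal{G}_k=(\mathcal{A}_k\cup\mathcal{B}_k,\mathcal{E}_k)$ be the complete bipartite graph with $\mathcal{E}_k=\{\{i,j\}\mid i\in\mathcal{A}_k,j\in\mathcal{B}_k\}$, with weights given by $w:\mathcal{E}_3\to\mathbb{R}$. For $k\in\{1,2\}$ let $\mathcal{M}_k$ be a bottleneck assignment of $\mathcal{G}_k$ and let $e_k\in\mathcal{M}_k$ be a critical bottleneck edge of $\mathcal{G}_k$ relative to $\mathcal{M}_k$ such that $\mathcal{G}_k$ is a bottleneck cluster with respect to $e_k$ (with the assignment $\mathcal{M}_k$). Let $\mathcal{T}_\mu(\mathcal{G}_1)=(\mathcal{V}_{\mu_1},\mathcal{E}_{\mu_1})$ and $\mathcal{T}_\nu(\mathcal{G}_1)=(\mathcal{V}_{\nu_1},\mathcal{E}_{\nu_1})$ be the agent and task trees of $\mathcal{G}_1$ (with respect to $\mathcal{M}_1$ and $e_1$). Let $e_3$ be a bottleneck edge of $\mathcal{G}_3$. Assume $w(e_1)>w(e_2)$ and that $\arg\max_{e\in\mathcal{M}_1}w(e)$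 is a singleton. Then $w(e_3)<w(e_1)$ if and only if there exist an agent $i\in\mathcal{A}_2$ and a task $j\in\mathcal{B}_2$ such that all of the following hold: (i) there exists an edge of $\mathcal{E}_3$ with weight less than $w(e_1)$ between $i$ and some $b'\in\mathcal{V}_{\nu_1}\cap\mathcal{B}_1$; (ii) there exists an edge of $\mathcal{E}_3$ with weight less than $w(e_1)$ between $j$ and some $a'\in\mathcal{V}_{\mu_1}\cap\mathcal{A}_1$; (iii) there exists a path $\mathcal{P}$ between $i$ and $j$, alternating relative to $\mathcal{M}_2$, containing only edges with weight less than $w(e_1)$, with $|\mathcal{P}\cap\mathcal{M}_2|>|\mathcal{P}\setminus\mathcal{M}_2|$.
   Context: An MCM is a matching of maximum cardinality. Let $\mathcal{G}=(\mathcal{V},\mathcal{E})$ be a complete bipartite graph between agents $\mathcal{A}$ and tasks $\mathcal{B}$ with $|\mathcal{A}|\ge|\mathcal{B}|$ and edge weights $w$. - *Bottleneck assignment*: an MCM $\mathcal{M}$ of $\mathcal{G}$ minimising $\max_{e\in\mathcal{M}}w(e)$ over all MCMs. *Bottleneck edge* of $\mathcal{G}$: any $e\in\arg\max_{e'\in\mathcal{M}}w(e')$ for some bottleneck assignment $\mathcal{M}$. - *Pruned edge set*: for an MCM $\mathcal{M}$, $\phi(\mathcal{G},\mathcal{M}):=\mathcal{M}\cup\{e\in\mathcal{E}\mid w(e)<\max_{e'\in\mathcal{M}}w(e')\}$. - A *path* is the edge set $\{\{v_k,v_{k+1}\}\mid 1\le k\le l\}$ of a sequence of distinct vertices $v_1,\dots,v_{l+1}$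 with consecutive vertices adjacent; it is a path between $v_1$ and $v_{l+1}$. - A path $\mathcal{P}$ is *alternating* relative to a matching $\mathcal{M}$ if each vertex incident to an edge of $\mathcal{P}$ is incident to at most one edge of $\mathcal{P}\cap\mathcal{M}$ and at most one edge of $\mathcal{P}\setminus\mathcal{M}$. A vertex is *free* relative to $\mathcal{M}$ if no edge of $\mathcal{M}$ is incident to it. An *augmenting path* relative to $\mathcal{M}$ is an alternating path whose two end vertices are both free. - *Critical bottleneck edge* of $\mathcal{G}$ relative to an MCM $\mathcal{M}$: an edge $e\in\arg\max_{e'\in\mathcal{M}}w(e')$ such that $\phi(\mathcal{G},\mathcal{M})\setminus\{e\}$ contains no augmenting path relative to $\mathcal{M}\setminus\{e\}$. - *Bottleneck cluster*: for a bottleneck assignment $\mathcal{M}$ and a bottleneck edge $e\in\mathcal{M}$, $\mathcal{G}$ is a bottleneck cluster with respect to $e$ if for every vertex $v\in\mathcal{V}$ there is an alternating path $\mathcal{P}\subseteq\phi(\mathcal{G},\mathcal{M})$ relative to $\mathcal{M}$ between $v$ and a vertex $v'\in e$. - *Tree*: a graph in which any two vertices are connected by exactly one path, with one vertex designated as root. *Alternating tree* relative to $\mathcal{M}$: a tree with root $r$ such that for every other vertex $v$ the path in the tree between $v$ and $r$ is alternating relative to $\mathcal{M}$. - *Agent and task trees*: let $\mathcal{M}$ be a bottleneck assignment, $e_c=\{a_c,b_c\}$ ($a_c\in\mathcal{A}$, $b_c\in\mathcal{B}$) a critical bottleneck edge relative to $\mathcal{M}$, and $\mathcal{G}$ a bottleneck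 cluster with respect to $e_c$. The agent tree $\mathcal{T}_\mu(\mathcal{G})=(\mathcal{V}_\mu,\mathcal{E}_\mu)$ and the task tree $\mathcal{T}_\nu(\mathcal{G})=(\mathcal{V}_\nu,\mathcal{E}_\nu)$ are alternating trees relative to $\mathcal{M}$ with $\mathcal{E}_\mu\cup\mathcal{E}_\nu=\phi(\mathcal{G},\mathcal{M})\setminus\{e_c\}$, $\mathcal{E}_\mu\cap\mathcal{E}_\nu=\emptyset$, $\mathcal{V}_\mu\cup\mathcal{V}_\nu=\mathcal{V}$, $\mathcal{V}_\mu\cap\mathcal{V}_\nu=\emptyset$, $a_c\in\mathcal{V}_\mu$ and $b_c\in\mathcal{V}_\nu$. *)

(* Defs.v *)
From HB Require Import structures.
From mathcomp Require Import all_boot all_order all_algebra.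
From mathcomp Require Import reals.

Set Implicit Arguments.
Unset Strict Implicit.
Unset Printing Implicit Defensive.

Import Order.TTheory GRing.Theory Num.Theory.
Local Open Scope ring_scope.

Record graph (V : finType) := Graph {
  vertices : {set V};
  edges : {set {set V}}
}.

(* The record does not impose this; [complete_bipartite A B] satisfies it as
   soon as A and B are disjoint. *)
Definition simple_graph (V : finType) (G : graph V) : Prop :=
  forall e, e \in edges G -> #|e| = 2%N /\ e \subset vertices G.

Definition complete_bipartite (V : finType) (A B : {set V}) : graph V :=
  Graph (A :|: B) [set [set i; j] | i in A, j in B].

Definition matching (V : finType) (G : graph V) (M : {set {set V}}) : Prop :=
  M \subset edges G /\ trivIset M.

Definition mcm (V : finType) (G : graph V) (M : {set {set V}}) : Prop :=
  matching G M /\ forall M', matching G M' -> (#|M'| <= #|M|)%N.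

(* Maximum of w over M; the value for empty M is a junk value. *)
Definition wmax (R : realType) (V : finType) (w : {set V} -> R)
    (M : {set {set V}}) : R :=
  if [pick e in M] is Some e0 then w [arg max_(e > e0 in M) w e]%O else 0.

Definition argmax (R : realType) (V : finType) (w : {set V} -> R)
    (M : {set {set V}}) : {set {set V}} :=
  [set e in M | w e == wmax w M].

Definition bottleneck_assignment (R : realType) (V : finType) (G : graph V)
    (w : {set V} -> R) (M : {set {set V}}) : Prop :=
  mcm G M /\ forall M', mcm G M' -> wmax w M <= wmax w M'.

Definition bottleneck_edge (R : realType) (V : finType) (G : graph V)
    (w : {set V} -> R) (e : {set V}) : Prop :=
  exists M, bottleneck_assignment G w M /\ e \in argmax w M.

Definition pruned (R : realType) (V : finType) (G : graph V)
    (w : {set V} -> R) (M : {set {set V}}) : {set {set V}} :=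
  M :|: [set e in edges G | w e < wmax w M].

Definition walk_edges (V : finType) (x : V) (s : seq V) : {set {set V}} :=
  [set:: pairmap (fun u v => [set u; v]) x s].

(* A path is an edge set, given by some sequence x :: s of distinct vertices.
   It has at least one edge: with an empty path allowed, a free vertex alone
   would count as an augmenting path. *)
Definition is_path (V : finType) (G : graph V) (x y : V)
    (P : {set {set V}}) : Prop :=
  exists s : seq V,
    [/\ s != [::], uniq (x :: s), {subset x :: s <= vertices G},
        path (fun u v => [set u; v] \in edges G) x s
      & last x s = y /\ P = walk_edges x s].

Definition alternating (V : finType) (M P : {set {set V}}) : Prop :=
  forall v, v \in cover P ->
    (#|[set e in P :&: M | v \in e]| <= 1)%N
    /\ (#|[set e in P :\: M | v \in e]| <= 1)%N.

Definition free (V : finType) (M : {set {set V}}) (v : V) : Prop :=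
  forall e, e \in M -> v \notin e.

Definition augmenting_path (V : finType) (G : graph V)
    (M P : {set {set V}}) : Prop :=
  exists x y, [/\ is_path G x y P, alternating M P, free M x & free M y].

Definition critical_bottleneck_edge (R : realType) (V : finType)
    (G : graph V) (w : {set V} -> R) (M : {set {set V}}) (e : {set V}) : Prop :=
  e \in argmax w M
  /\ ~ exists P : {set {set V}},
         P \subset pruned G w M :\ e /\ augmenting_path G (M :\ e) P.

Definition bottleneck_cluster (R : realType) (V : finType) (G : graph V)
    (w : {set V} -> R) (M : {set {set V}}) (e : {set V}) : Prop :=
  forall v, v \in vertices G ->
    exists (v' : V) (P : {set {set V}}),
      [/\ v' \in e, is_path G v v' P, P \subset pruned G w M
         & alternating M P].

Definition tree (V : finType) (T : graph V) (r : V) : Prop :=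
  [/\ simple_graph T, r \in vertices T
    & forall u v, u \in vertices T -> v \in vertices T -> u != v ->
        exists! P, is_path T u v P].

Definition alternating_tree (V : finType) (M : {set {set V}}) (T : graph V)
    (r : V) : Prop :=
  tree T r
  /\ forall v P, v \in vertices T -> v != r -> is_path T v r P ->
       alternating M P.

(* The roots of the two trees are left arbitrary. *)
Definition agent_task_trees (R : realType) (V : finType) (A B : {set V})
    (w : {set V} -> R) (M : {set {set V}}) (ec : {set V})
    (Tmu Tnu : graph V) : Prop :=
  let G := complete_bipartite A B in
  [/\ exists r, alternating_tree M Tmu r,
      exists r, alternating_tree M Tnu r,
      edges Tmu :|: edges Tnu = pruned G w M :\ ec
        /\ edges Tmu :&: edges Tnu = set0,
      vertices Tmu :|: vertices Tnu = vertices G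
        /\ vertices Tmu :&: vertices Tnu = set0
    & exists a b, [/\ a \in A, b \in B, ec = [set a; b],
                      a \in vertices Tmu & b \in vertices Tnu]].

(* Main.v *)
(* Let W = w e1.  A vertex left free by M_k would, through the cluster condition,
   start a path that is augmenting relative to M_k :\ e_k, so criticality makes
   M1 and M2 perfect.  As e1 is the only edge of M1 of weight >= W, the trees
   split the edges of G1 lighter than W along Vmu and Vnu, and G3 beats W iff it
   has a perfect matching of edges lighter than W.
   Given i, j and P, swapping M1 :\ e1 along the cluster paths from b' (inside
   Vnu) and from a' (inside Vmu), and M2 along P, frees exactly b', a', i and j,
   which the two light edges then join.  Conversely a light perfect matching
   satisfies Hall's condition, whereas the tasks of Vnu outnumber its agents by
   one; hence Vmu is reached from Vnu through G2. *)

Require Import Defs.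
From HB Require Import structures.
From mathcomp Require Import all_boot all_order all_algebra.
From mathcomp Require Import reals.
From mathcomp Require Import zify.

Set Implicit Arguments.
Unset Strict Implicit.
Unset Printing Implicit Defensive.

Import Order.TTheory GRing.Theory Num.Theory.
Local Open Scope ring_scope.

(** * Matchings as disjoint families of edges, and the vertices they cover *)

Lemma trivIset_eq (V : finType) (M : {set {set V}}) (e f : {set V}) (v : V) :
  trivIset M -> e \in M -> f \in M -> v \in e -> v \in f -> e = f.
Proof.
move=> tM eM fM ve vf; apply/eqP; apply: contraTT vf => nef.
by rewrite (disjointFr (trivIsetP tM e f eM fM nef)).
Qed.

Lemma eq_trivIset (V : finType) (M : {set {set V}}) :
  (forall e f v, e \in M -> f \in M -> v \in e -> v \in f -> e = f) ->
  trivIset M.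
Proof.
move=> MP; apply/trivIsetP => e f eM fM; apply: contraNT.
case/pred0Pn => v /= /andP[ve vf]; exact/eqP/(MP e f v).
Qed.

Lemma mem_cover (V : finType) (M : {set {set V}}) (e : {set V}) (v : V) :
  e \in M -> v \in e -> v \in cover M.
Proof. by move=> eM ve; apply/bigcupP; exists e. Qed.

Lemma coverP (V : finType) (M : {set {set V}}) (v : V) :
  reflect (exists2 e, e \in M & v \in e) (v \in cover M).
Proof. exact: bigcupP. Qed.

Lemma coverU (V : finType) (M N : {set {set V}}) :
  cover (M :|: N) = cover M :|: cover N.
Proof. by rewrite /cover bigcup_setU. Qed.

Lemma coverS (V : finType) (M N : {set {set V}}) :
  M \subset N -> cover M \subset cover N.
Proof. by move/setUidPr<-; rewrite coverU subsetUl. Qed.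

Lemma card_cover_meet (V : finType) (M : {set {set V}}) (S : {set V}) (n : nat) :
  trivIset M -> (forall e, e \in M -> #|e :&: S| = n) ->
  #|cover M :&: S| = (#|M| * n)%N.
Proof.
move=> tM MS; rewrite -sum1_card.
under eq_bigl do rewrite inE.
rewrite (big_trivIset_cond M tM) -sum_nat_const; apply: eq_bigr => e eM.
by rewrite -(MS e eM) -sum1_card; apply: eq_bigl => v; rewrite inE.
Qed.

(** Two families with disjoint covers could share only the empty set, which [set0 \notin M]
    excludes; hence the cardinalities add. *)
Lemma trivIset_disjointU (V : finType) (M N : {set {set V}}) :
  trivIset M -> trivIset N -> set0 \notin M -> [disjoint cover M & cover N] ->
  trivIset (M :|: N) /\ #|M :|: N| = (#|M| + #|N|)%N.
Proof.
move=> tM tN M0 dMN; split; first exact: trivIsetU.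
suff MN0 : M :&: N = set0 by rewrite cardsU MN0 cards0 subn0.
apply/eqP; apply: contraNT M0 => /set0Pn[e /setIP[eM eN]].
suff <- : e = set0 by [].
apply/eqP; apply: contraTT dMN => /set0Pn[v ve]; apply/pred0Pn; exists v => /=.
by rewrite (mem_cover eM ve) (mem_cover eN ve).
Qed.

Lemma trivIset_add_edge (V : finType) (M : {set {set V}}) (u v : V) :
  trivIset M -> u \notin cover M -> v \notin cover M ->
  [/\ trivIset ([set u; v] |: M), #|[set u; v] |: M| = #|M|.+1
    & cover ([set u; v] |: M) = [set u; v] :|: cover M].
Proof.
move=> tM uM vM; have [||||tU cU] := @trivIset_disjointU V [set [set u; v]] M => //.
- exact: trivIset1.
- by apply/negP => /set1P E; have := set21 u v; rewrite -E inE.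
- rewrite cover1 disjoints_subset; apply/subsetP => x.
  by case/set2P=> ->; rewrite inE.
by split=> //; rewrite ?cU ?cards1 // coverU cover1.
Qed.

(** * Walks and their edge sets *)

Lemma walk_edges0 (V : finType) (x : V) : walk_edges x [::] = set0.
Proof. by apply/setP => e; rewrite !inE. Qed.

Lemma walk_edges_cons (V : finType) (x y : V) (s : seq V) :
  walk_edges x (y :: s) = [set x; y] |: walk_edges y s.
Proof. by rewrite /walk_edges /= set_cons. Qed.

Lemma walk_edges_vertex (V : finType) (x : V) (s : seq V) (e : {set V}) (v : V) :
  e \in walk_edges x s -> v \in e -> v \in x :: s.
Proof.
elim: s x => [|y s IH] x; first by rewrite walk_edges0 inE.
rewrite walk_edges_cons => /setU1P[->|es ve].
  by rewrite !inE => /orP[] ->; rewrite ?orbT.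
by rewrite in_cons IH ?orbT.
Qed.

Lemma cover_walk_edges (V : finType) (x : V) (s : seq V) :
  cover (walk_edges x s) \subset [set:: x :: s].
Proof.
by apply/subsetP => v /coverP[e es ve]; rewrite inE (walk_edges_vertex es ve).
Qed.

Lemma card_walk_edge (V : finType) (x : V) (s : seq V) (e : {set V}) :
  uniq (x :: s) -> e \in walk_edges x s -> #|e| = 2%N.
Proof.
elim: s x => [|y s IH] x; first by rewrite walk_edges0 inE.
rewrite walk_edges_cons cons_uniq => /andP[xs us] /setU1P[->|]; last exact: IH.
by move: xs; rewrite cards2 inE negb_or => /andP[->].
Qed.

Lemma card_walk_edges (V : finType) (x : V) (s : seq V) :
  uniq (x :: s) -> #|walk_edges x s| = size s.
Proof.
elim: s x => [|y s IH] x; first by rewrite walk_edges0 cards0.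
rewrite walk_edges_cons cons_uniq => /andP[xs us].
suff /negPf ns : [set x; y] \notin walk_edges y s by rewrite cardsU1 ns IH.
by apply: contra xs => es; apply: (walk_edges_vertex es); rewrite set21.
Qed.

Lemma walk_edges_head (V : finType) (x : V) (s : seq V) (e f : {set V}) :
  uniq (x :: s) -> e \in walk_edges x s -> f \in walk_edges x s ->
  x \in e -> x \in f -> e = f.
Proof.
case: s => [|y s]; first by rewrite walk_edges0 inE.
rewrite walk_edges_cons cons_uniq => /andP[xs _].
have notin g : g \in walk_edges y s -> x \notin g.
  by move=> gs; apply: contra xs; apply: walk_edges_vertex.
move=> /setU1P[->|/notin/negP//] /setU1P[->//|/notin/negP//].
Qed.

Lemma walk_edges_last (V : finType) (x : V) (s : seq V) (e f : {set V}) :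
  uniq (x :: s) -> e \in walk_edges x s -> f \in walk_edges x s ->
  last x s \in e -> last x s \in f -> e = f.
Proof.
elim: s x => [|y [|z s] IH] x; first by rewrite walk_edges0 inE.
  by rewrite walk_edges_cons walk_edges0 setU0 => _ /set1P-> /set1P->.
rewrite walk_edges_cons => /andP[xs us].
have lx : last x [:: y, z & s] \notin [set x; y].
  have lz : last z s \in z :: s by apply: mem_last.
  rewrite !inE /=; apply/negP => /orP[]/eqP E.
    by move: xs; rewrite -E in_cons lz orbT.
  by move: us; rewrite /= -E lz.
move=> /setU1P[->|es] /setU1P[->|fs] //; rewrite ?(negPf lx) //=.
exact: (IH y us).
Qed.

Lemma walk_parity (V : finType) (c : pred V) (x : V) (s : seq V) :
  path (fun u v => c u != c v) x s -> c (last x s) = c x (+) odd (size s).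
Proof.
elim: s x => [|y s IH] x /=; first by rewrite addbF.
by case/andP=> cxy /IH->; move: cxy; case: (c x); case: (c y); case: odd.
Qed.

(** * Exchanging a matching along a walk *)

(** The symmetric difference of [M] and [P]. *)
Definition swap (V : finType) (M P : {set {set V}}) : {set {set V}} :=
  (M :\: P) :|: (P :\: M).

Lemma swap_sub (V : finType) (M P : {set {set V}}) : swap M P \subset M :|: P.
Proof. by rewrite setUSS // subsetDl. Qed.

(** A new collision could only occur between a kept edge of [M] and an added edge of [P]. By the
    cover condition the [M]-edge at such a vertex lies in [P], so it was removed. *)
Lemma trivIset_swap (V : finType) (M P : {set {set V}}) :
  trivIset M -> trivIset (P :\: M) ->
  cover P :&: cover M \subset cover (P :&: M) -> trivIset (swap M P).
Proof.
move=> tM tPM /subsetP cPM.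
have aux e f v : e \in M :\: P -> f \in P :\: M -> v \in e -> v \in f -> False.
  move=> /setDP[eM eP] /setDP[fP fM] ve vf.
  have /coverP[g /setIP[gP gM] vg] : v \in cover (P :&: M).
    by apply: cPM; rewrite inE (mem_cover eM ve) (mem_cover fP vf).
  by move: eP; rewrite (trivIset_eq tM eM gM ve vg) gP.
apply: eq_trivIset => e f v /setUP[eM|eP] /setUP[fM|fP] ve vf.
- by apply: (trivIset_eq (trivIsetD _ tM)) ve vf; eassumption.
- by case: (aux e f v).
- by case: (aux f e v).
- exact: (trivIset_eq tPM) ve vf.
Qed.

Lemma card_swap (V : finType) (M P : {set {set V}}) :
  (#|swap M P| + #|P :&: M| = #|M| + #|P :\: M|)%N.
Proof.
rewrite cardsU -[#|M|](cardsID P) (setIC M).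
have -> : (M :\: P) :&: (P :\: M) = set0.
  by apply/setP => e; rewrite !inE; case: (e \in M); case: (e \in P).
by rewrite cards0; lia.
Qed.

Lemma notin_cover_swap (V : finType) (M P : {set {set V}}) (x : V) :
  trivIset M -> x \in cover (P :&: M) ->
  (forall e f, e \in P -> f \in P -> x \in e -> x \in f -> e = f) ->
  x \notin cover (swap M P).
Proof.
move=> tM /coverP[e /setIP[eP eM] xe] xP; apply/negP => /coverP[f].
case/setUP=> /setDP[f1 f2] xf.
  by rewrite (trivIset_eq tM f1 eM xf xe) eP in f2.
by rewrite (xP f e f1 eP xf xe) eM in f2.
Qed.

Lemma card_cover_walk_sub (V : finType) (x : V) (s : seq V) (K : {set {set V}}) :
  uniq (x :: s) -> K \subset walk_edges x s -> trivIset K ->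
  #|cover K| = (#|K| * 2)%N.
Proof.
move=> us /subsetP Ks tK; rewrite -[cover K]setIT; apply: card_cover_meet => // e.
by move/Ks/(card_walk_edge us); rewrite setIT.
Qed.

Lemma card_set_seq (V : finType) (s : seq V) : uniq s -> #|[set:: s]| = size s.
Proof. by move=> us; rewrite cardsE; exact/card_uniqP. Qed.

(* The path starts and ends with edges of M and covers only matched vertices,
   by counting: 2 |P :&: M| <= size s + 1 = |P| + 1 <= 2 |P :&: M|. *)
Lemma swap_odd_walk (V : finType) (M : {set {set V}}) (x : V) (s : seq V) :
  let P := walk_edges x s in
  trivIset M -> uniq (x :: s) -> trivIset (P :\: M) ->
  (#|P :\: M| < #|P :&: M|)%N ->
  let N := swap M P in
  [/\ trivIset N, #|N|.+1 = #|M|, x \notin cover N, last x s \notin cover N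
    & cover N \subset cover M].
Proof.
move=> P tM us tPM ltPM N.
have tI : trivIset (P :&: M) by apply: trivIsetS tM; apply: subsetIr.
have cI := card_cover_walk_sub us (subsetIl P M) tI.
have sI : cover (P :&: M) \subset [set:: x :: s].
  apply: subset_trans (cover_walk_edges x s); exact/coverS/subsetIl.
have cP : (#|P :&: M| + #|P :\: M|)%N = size s by rewrite cardsID card_walk_edges.
have cS := card_set_seq us; rewrite /= in cS.
have leI := subset_leq_card sI; rewrite cS cI in leI.
have eI : cover (P :&: M) = [set:: x :: s] by apply/eqP; rewrite eqEcard sI cS cI; lia.
have cvP : cover P \subset cover (P :&: M) by rewrite eI; apply: cover_walk_edges.
have cSw := card_swap M P.
split.
- by apply: trivIset_swap => //; apply: subset_trans cvP; apply: subsetIl.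
- by rewrite /N; lia.
- apply: notin_cover_swap => //; first by rewrite eI inE mem_head.
  by move=> e f; apply: walk_edges_head.
- apply: notin_cover_swap => //; first by rewrite eI inE mem_last.
  by move=> e f; apply: walk_edges_last.
- apply: subset_trans (coverS (swap_sub M P)) _; rewrite coverU subUset subxx.
  by apply: subset_trans cvP _; apply/coverS/subsetIr.
Qed.

(** Let [n = size s], which is even. [P :&: M] misses the last vertex, so it has at most [n / 2]
    edges; [P :\: M] has at most [n / 2] by parity. Together they have [n], so both bounds are
    equalities and [P :&: M] covers every vertex of the walk but the last. *)
Lemma swap_even_walk (V : finType) (M : {set {set V}}) (x : V) (s : seq V) :
  let P := walk_edges x s in
  trivIset M -> uniq (x :: s) -> trivIset (P :\: M) ->
  ~~ odd (size s) -> last x s \notin cover M ->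
  let N := swap M P in
  [/\ trivIset N, #|N| = #|M| & x \notin cover N].
Proof.
move=> P tM us tPM os lM N.
have tI : trivIset (P :&: M) by apply: trivIsetS tM; apply: subsetIr.
have cI := card_cover_walk_sub us (subsetIl P M) tI.
have cD := card_cover_walk_sub us (subsetDl P M) tPM.
have sI : cover (P :&: M) \subset [set:: x :: s] :\ last x s.
  rewrite subsetD1; apply/andP; split; last first.
    by apply: contra lM; apply/subsetP/coverS/subsetIr.
  apply: subset_trans (cover_walk_edges x s); exact/coverS/subsetIl.
have sD : cover (P :\: M) \subset [set:: x :: s].
  apply: subset_trans (cover_walk_edges x s); exact/coverS/subsetDl.
have cP : (#|P :&: M| + #|P :\: M|)%N = size s by rewrite cardsID card_walk_edges.
have cS := card_set_seq us.
have cS1 : #|[set:: x :: s] :\ last x s| = size s.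
  by have := cardsD1 (last x s) [set:: x :: s]; rewrite inE mem_last cS => -[->].
have leI := subset_leq_card sI; have leD := subset_leq_card sD.
rewrite cS1 cI in leI; rewrite cS cD /= in leD.
have s2 : size s = ((size s)./2 * 2)%N by rewrite muln2 even_halfK.
have eI : cover (P :&: M) = [set:: x :: s] :\ last x s.
  apply/eqP; rewrite eqEcard sI cS1 cI /=; move: cP leI leD s2.
  by move: (size s)./2 (size s) #|P :&: M| #|P :\: M|; clear; lia.
have epq : #|P :&: M| = #|P :\: M|.
  move: cP (cI); rewrite eI cS1.
  by move: (size s) #|P :&: M| #|P :\: M|; clear; lia.
have cSw := card_swap M P.
split.
- apply: trivIset_swap => //; rewrite eI; apply/subsetP => v /setIP[vP vM].
  rewrite in_setD1 (subsetP (cover_walk_edges x s)) // andbT.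
  by apply: contra lM => /eqP<-.
- by apply: (@addIn #|P :&: M|); rewrite cSw epq.
(* In an empty walk [x] is itself the unmatched end and the swap leaves [M] unchanged. Otherwise [x]
   is not the last vertex, hence is covered by [P :&: M]. *)
move: eI; clear -tM us tPM os lM; case: s @P @N us tPM os lM => [|y s] P N.
  by rewrite /N /P walk_edges0 /swap setD0 set0D setU0.
move=> us tPM os lM eI; apply: notin_cover_swap => //.
  rewrite eI !inE eqxx andbT.
  move: us; rewrite cons_uniq => /andP[xs _]; apply: contra xs => /eqP{1}->.
  exact: (mem_last y s).
by move=> e f; apply: walk_edges_head.
Qed.

(** * Alternation and truncation of walks *)

(** A matching [M] has at most one edge at each vertex, so alternation relative to it says exactly
    that [P :\: M] is a matching; the next lemma is the converse. *)
Lemma alternating_trivIset (V : finType) (M P : {set {set V}}) :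
  alternating M P -> trivIset (P :\: M).
Proof.
move=> aP; apply: eq_trivIset => e f v eP fP ve vf.
have [_ /card_le1_eqP] := aP v (mem_cover (subsetP (subsetDl P M) _ eP) ve).
by apply; rewrite inE ?eP ?fP.
Qed.

Lemma trivIset_alternating (V : finType) (M P : {set {set V}}) :
  trivIset M -> trivIset (P :\: M) -> alternating M P.
Proof.
move=> tM tP v _; split; apply/card_le1_eqP => e f.
  rewrite !inE => /andP[/andP[_ eM] ve] /andP[/andP[_ fM] vf].
  exact: (trivIset_eq tM fM eM vf ve).
rewrite !(in_set, in_setD) -!in_setD => /andP[eP ve] /andP[fP vf].
exact: (trivIset_eq tP fP eP vf ve).
Qed.

(** Cuts the walk at its first vertex on [e]. Every edge before that point has an endpoint outside
    [e], so none of them is [e]. *)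
Lemma walk_truncate (V : finType) (e : {set V}) (x : V) (s : seq V) :
  last x s \in e -> exists s1 s2, [/\ s = s1 ++ s2, last x s1 \in e
    & e \notin walk_edges x s1].
Proof.
elim: s x => [|y s IH] x /= le.
  by exists [::], [::]; rewrite walk_edges0 inE.
have [xe|xe] := boolP (x \in e).
  by exists [::], (y :: s); rewrite walk_edges0 inE.
have [s1 [s2 [-> le1 es1]]] := IH y le.
exists (y :: s1), s2; split=> //; rewrite walk_edges_cons in_setU1 negb_or es1 andbT.
by apply: contra xe => /eqP->; rewrite set21.
Qed.

Lemma walk_edges_cat (V : finType) (x : V) (s1 s2 : seq V) :
  walk_edges x s1 \subset walk_edges x (s1 ++ s2).
Proof.
elim: s1 x => [|y s IH] x; first by rewrite walk_edges0 sub0set.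
by rewrite cat_cons !walk_edges_cons setUS.
Qed.

(** * Maximal weights and the pruned edge set *)

Lemma wmax_ge (R : realType) (V : finType) (w : {set V} -> R)
  (M : {set {set V}}) (e : {set V}) : e \in M -> w e <= wmax w M.
Proof.
move=> eM; rewrite /wmax; case: pickP => [e0 e0M|/(_ e)]; last by rewrite eM.
by case: arg_maxP => // f fM /(_ e eM).
Qed.

Lemma wmax_lt (R : realType) (V : finType) (w : {set V} -> R)
  (M : {set {set V}}) (c : R) :
  M != set0 -> (forall e, e \in M -> w e < c) -> wmax w M < c.
Proof.
move=> /set0Pn[e eM] Mc; rewrite /wmax; case: pickP => [e0 e0M|/(_ e)].
  by case: arg_maxP => // f fM _; apply: Mc.
by rewrite eM.
Qed.

(** Every edge of [M] other than its unique heaviest one is strictly lighter than the maximum, so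
    deleting [e] leaves exactly the light edges of [G]. *)
Lemma pruned_setD1 (R : realType) (V : finType) (G : graph V)
  (w : {set V} -> R) (M : {set {set V}}) (e f : {set V}) :
  M \subset edges G -> argmax w M = [set e] ->
  (f \in pruned G w M :\ e) = (f \in edges G) && (w f < wmax w M).
Proof.
move=> /subsetP MG eM.
have argE g : (g \in argmax w M) = (g == e) by rewrite eM inE.
have we : w e = wmax w M.
  by apply/eqP; have := argE e; rewrite eqxx inE => /andP[].
have := argE f; rewrite !inE => fE.
have [->|nfe] := eqVneq f e; first by rewrite we ltxx andbF.
rewrite (negPf nfe) in fE; rewrite /=.
have [fM|//] := boolP (f \in M).
by rewrite MG //= lt_neqAle wmax_ge // andbT; move: fE; rewrite fM /= => ->.
Qed.

(** * Complete bipartite graphs and the size of their maximum matchings *)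

Lemma complete_bipartiteP (V : finType) (A B : {set V}) (e : {set V}) :
  reflect (exists a b, [/\ a \in A, b \in B & e = [set a; b]])
          (e \in edges (complete_bipartite A B)).
Proof.
apply: (iffP imset2P) => [[a b aA bB ->]|[a [b [aA bB ->]]]]; first by exists a, b.
by exists a b.
Qed.

Lemma complete_bipartite_edge (V : finType) (A B : {set V}) (a b : V) :
  a \in A -> b \in B -> [set a; b] \in edges (complete_bipartite A B).
Proof. by move=> aA bB; apply/complete_bipartiteP; exists a, b. Qed.

Lemma complete_bipartiteS (V : finType) (A A' B B' : {set V}) :
  A \subset A' -> B \subset B' ->
  edges (complete_bipartite A B) \subset edges (complete_bipartite A' B').
Proof.
move=> /subsetP sA /subsetP sB; apply/subsetP => e.
case/complete_bipartiteP=> a [b [aA bB ->]].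
by apply: complete_bipartite_edge; [apply: sA|apply: sB].
Qed.

Lemma complete_bipartiteC (V : finType) (A B : {set V}) :
  edges (complete_bipartite A B) = edges (complete_bipartite B A).
Proof.
apply/setP => e; apply/complete_bipartiteP/complete_bipartiteP => -[a [b [aA bB ->]]];
  by exists b, a; rewrite setUC.
Qed.

Lemma complete_bipartite_sub (V : finType) (A B : {set V}) (e : {set V}) :
  e \in edges (complete_bipartite A B) -> e \subset A :|: B.
Proof.
case/complete_bipartiteP=> a [b [aA bB ->]].
by apply/subsetP => v /set2P[]->; rewrite inE ?aA ?bB ?orbT.
Qed.

Lemma card_edge_side (V : finType) (A B : {set V}) (e : {set V}) :
  [disjoint A & B] -> e \in edges (complete_bipartite A B) -> #|e :&: B| = 1%N.
Proof.
move=> dAB /complete_bipartiteP[a [b [aA bB ->]]].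
apply/eqP/cards1P; exists b; apply/setP => v; rewrite !inE.
have [->|_] := eqVneq v b; first by rewrite orbT bB.
by rewrite orbF; apply/andP => -[/eqP-> ]; rewrite (disjointFr dAB).
Qed.

Lemma edge_side (V : finType) (A B : {set V}) (u v : V) :
  [disjoint A & B] -> [set u; v] \in edges (complete_bipartite A B) ->
  (u \in B) != (v \in B).
Proof.
move=> dAB uv; have E := card_edge_side dAB uv; apply/eqP => uvB.
have [uB|uB] := boolP (u \in B); last first.
  suff e0 : [set u; v] :&: B = set0 by rewrite e0 cards0 in E.
  apply/setP => x; rewrite !inE; apply/andP => -[/orP[]/eqP->]; last rewrite -uvB;
  by rewrite (negPf uB).
case/complete_bipartiteP: uv => a [b [aA _ uvE]].
have : a \in [set u; v] by rewrite uvE set21.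
have aB := disjointFr dAB aA.
by case/set2P=> E'; move: aB; rewrite E' -?uvB uB.
Qed.

Lemma card_matching_side (V : finType) (A B : {set V}) (M : {set {set V}}) :
  [disjoint A & B] -> M \subset edges (complete_bipartite A B) -> trivIset M ->
  #|cover M :&: B| = #|M|.
Proof.
move=> dAB /subsetP MG tM; rewrite (@card_cover_meet _ _ _ 1) ?muln1 //.
by move=> e /MG; apply: card_edge_side.
Qed.

Lemma card_matching_agents (V : finType) (A B : {set V}) (M : {set {set V}}) :
  [disjoint A & B] -> M \subset edges (complete_bipartite A B) -> trivIset M ->
  #|cover M :&: A| = #|M|.
Proof.
by rewrite disjoint_sym complete_bipartiteC; apply: card_matching_side.
Qed.

(** Each edge of a matching uses up a task of its own, so [#|B|] bounds every matching. *)
Lemma mcm_of_card (V : finType) (A B : {set V}) (M : {set {set V}}) :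
  [disjoint A & B] -> M \subset edges (complete_bipartite A B) -> trivIset M ->
  #|M| = #|B| -> mcm (complete_bipartite A B) M.
Proof.
move=> dAB MG tM cM; split=> // M' [M'G tM'].
by rewrite cM -(card_matching_side dAB M'G tM') subset_leq_card // subsetIr.
Qed.

(** A matching smaller than [B], hence than [A], leaves a free vertex on each side; completeness
    joins the two by an edge, against maximality. *)
Lemma card_mcm (V : finType) (A B : {set V}) (M : {set {set V}}) :
  [disjoint A & B] -> (#|B| <= #|A|)%N -> mcm (complete_bipartite A B) M ->
  #|M| = #|B|.
Proof.
move=> dAB leBA [[MG tM] maxM].
have cA := card_matching_agents dAB MG tM; have cB := card_matching_side dAB MG tM.
apply/eqP; rewrite eqn_leq -{1}cB subset_leq_card ?subsetIr //= leqNgt.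
apply/negP => ltMB.
have free_vertex (S : {set V}) : #|cover M :&: S| = #|M| -> (#|M| < #|S|)%N ->
    exists2 v, v \in S & v \notin cover M.
  move=> cS ltS; apply/subsetPn; apply/negP => SM; move: ltS.
  by rewrite -cS (setIidPr SM) ltnn.
have [b bB bM] := free_vertex B cB ltMB.
have [a aA aM] := free_vertex A cA (leq_trans ltMB leBA).
have [tU cU _] := trivIset_add_edge tM aM bM.
suff /maxM : matching (complete_bipartite A B) ([set a; b] |: M).
  by rewrite cU ltnn.
by split=> //; rewrite subUset sub1set complete_bipartite_edge.
Qed.

(** * Consequences of the cluster condition and of criticality *)

Lemma is_path_truncate (V : finType) (G : graph V) (x y : V) (P : {set {set V}})
  (e : {set V}) :
  is_path G x y P -> y \in e -> exists s,
    [/\ uniq (x :: s), {subset x :: s <= vertices G},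
        path (fun u v => [set u; v] \in edges G) x s, last x s \in e
      & walk_edges x s \subset P :\ e].
Proof.
move=> [s [_ us sG ps [ls ->]]]; rewrite -ls => /walk_truncate[s1 [s2 [sE ls1 es1]]].
rewrite {}sE in us sG ps *; exists s1; split=> //.
- by move: us; rewrite -cat_cons cat_uniq => /and3P[].
- by move=> v vs; apply: sG; rewrite -cat_cons mem_cat vs.
- by move: ps; rewrite cat_path => /andP[].
- by rewrite subsetD1 walk_edges_cat.
Qed.

(** Deleting [e] from [M] can enlarge the unmatched part of a path only by [e] itself, and [Q]
    avoids [e]. *)
Lemma alternating_sub (V : finType) (M P : {set {set V}}) (e : {set V})
  (Q : {set {set V}}) :
  trivIset M -> alternating M P -> Q \subset P :\ e -> alternating (M :\ e) Q.
Proof.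
move=> tM aP /subsetD1P[QP eQ]; apply: trivIset_alternating.
  exact: trivIsetD.
apply: trivIsetS (alternating_trivIset aP); apply/subsetP => f.
rewrite !inE negb_and negbK => /andP[fN fQ]; rewrite (subsetP QP) // andbT.
by case/orP: fN => // /eqP E; rewrite E (negPf eQ) in fQ.
Qed.

(* An unmatched agent would be joined to e by an alternating path, whose part
   up to the first vertex of e is augmenting relative to M :\ e. *)
Lemma critical_cluster_covers (R : realType) (V : finType) (G : graph V)
  (w : {set V} -> R) (M : {set {set V}}) (e : {set V}) :
  trivIset M -> critical_bottleneck_edge G w M e -> bottleneck_cluster G w M e ->
  vertices G \subset cover M.
Proof.
move=> tM [eM noaug] clu; apply/subsetP => v vG; apply/negPn/negP => vM.
have {}eM : e \in M by move: eM; rewrite inE => /andP[].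
have [v' [P [v'e pathP Ppr altP]]] := clu v vG.
have [s [us sG ps ls sP]] := is_path_truncate pathP v'e.
apply: noaug; exists (walk_edges v s); split.
  exact: subset_trans sP (setSD _ Ppr).
exists v, (last v s); split.
(* The unmatched [v] is not on [e], so the truncated walk has at least one edge. *)
- exists s; split=> //; apply/eqP => s0; move: ls vM; rewrite s0 /= => ve.
  by rewrite (mem_cover eM ve).
- exact: alternating_sub tM altP sP.
- by move=> f /setD1P[_ fM]; apply: contra vM => /(mem_cover fM).
(* The walk ends on [e], the only edge of [M] at that vertex, so deleting [e] frees it. *)
- move=> f /setD1P[fe fM]; apply: contra fe => lf.
  exact/eqP/(trivIset_eq tM fM eM lf ls).
Qed.

Lemma walk_closed (V : finType) (X : {set V}) (x : V) (s : seq V) :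
  (forall f, f \in walk_edges x s -> f \subset X \/ [disjoint f & X]) ->
  x \in X -> {subset x :: s <= X}.
Proof.
elim: s x => [|y s IH] x fX xX; first by move=> v; rewrite inE => /eqP->.
have yX : y \in X.
  case: (fX [set x; y]); first by rewrite walk_edges_cons setU11.
    by move/subsetP; apply; rewrite set22.
  by move/disjointFr => /(_ x (set21 _ _)); rewrite xX.
move=> v; rewrite in_cons => /predU1P[->//|]; apply: (IH y) => // f fs.
by apply: fX; rewrite walk_edges_cons setU1r.
Qed.

(* Moves the vertex of X left unmatched by M :\ e from c to x. *)
Lemma cluster_swap (R : realType) (V : finType) (A B X : {set V})
  (w : {set V} -> R) (M : {set {set V}}) (e : {set V}) (c x : V) :
  let G := complete_bipartite A B in
  [disjoint A & B] -> trivIset M -> e \in M -> bottleneck_cluster G w M e ->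
  (forall f, f \in pruned G w M :\ e -> f \subset X \/ [disjoint f & X]) ->
  e :&: X = [set c] -> x \in X -> x \in A :|: B -> (x \in B) = (c \in B) ->
  exists N : {set {set V}}, [/\ N \subset pruned G w M :\ e, trivIset N,
    cover N \subset X, x \notin cover N & #|N| = #|[set f in M :\ e | f \subset X]|].
Proof.
move=> G dAB tM eM clu clX eX xX xG xB.
have [v' [P [v'e pathP Ppr altP]]] := clu x xG.
have [s [us sG ps ls sP]] := is_path_truncate pathP v'e.
(* No edge of [pruned G w M :\ e] crosses the boundary of [X], so the walk stays in [X] and must end
   at [c], the only vertex of [e] there. *)
have sX : {subset x :: s <= X}.
  apply: walk_closed xX => f /(subsetP sP) fP; apply: clX.
  exact: (subsetP (setSD _ Ppr)).
have lc : last x s = c by apply/set1P; rewrite -eX inE ls sX ?mem_last.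
set MX := [set f in M :\ e | f \subset X].
have sMX : MX \subset M :\ e by apply/subsetP => f; rewrite inE => /andP[].
have WX f : f \in walk_edges x s -> f \subset X.
  by move=> fs; apply/subsetP => v /(walk_edges_vertex fs)/sX.
have [|||||tN cN xN] := @swap_even_walk V MX x s.
- by apply: trivIsetS tM; apply: subset_trans sMX (subsetDl _ _).
- by [].
- apply: trivIsetS (alternating_trivIset (alternating_sub tM altP sP)).
  apply/subsetP => f /setDP[fs]; rewrite in_set (WX f fs) andbT => fM.
  by apply/setDP.
(* Sides alternate along the walk and its ends [x] and [c] are on the same side, so its length is
   even. *)
- have parB : path (fun u v => (u \in B) != (v \in B)) x s.
    by apply: sub_path ps => u v; apply: edge_side.
  have := walk_parity (c := mem B) parB; rewrite lc /= -xB.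
  by case: (x \in B); case: odd.
- apply/negP => /coverP[f /(subsetP sMX)/setD1P[fe fM] lf].
  by case/eqP: fe; apply: (trivIset_eq tM fM eM lf ls).
exists (swap MX (walk_edges x s)); split=> //.
- apply: subset_trans (swap_sub _ _) _; rewrite subUset.
  rewrite (subset_trans sP (setSD _ Ppr)) andbT.
  by apply: subset_trans sMX _; apply: setSD; apply: subsetUl.
- apply: subset_trans (coverS (swap_sub _ _)) _; apply/bigcupsP => f.
  by case/setUP=> [|/WX//]; rewrite inE => /andP[].
Qed.

(** * Exchange walks through the second cluster *)

(** With [m u] the agent matched to the task [u], this spells out the walk [m t], [t], [m u], [u],
    and so on for [u] in [p]. Its first vertex [m t] is omitted because [path] and [walk_edges] take
    it separately. *)
Definition exchange_walk (V : eqType) (m : V -> V) (t : V) (p : seq V) : seq V :=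
  t :: flatten [seq [:: m u; u] | u <- p].

Lemma exchange_walk_cons (V : eqType) (m : V -> V) (t u : V) (p : seq V) :
  exchange_walk m t (u :: p) = [:: t, m u & exchange_walk m u p].
Proof. by []. Qed.

Lemma last_exchange_walk (V : eqType) (m : V -> V) (x t : V) (p : seq V) :
  last x (exchange_walk m t p) = last t p.
Proof. by elim: p x t => //= u p IH x t; apply: (IH u u). Qed.

Lemma mem_exchange_walk (V : eqType) (m : V -> V) (t v : V) (p : seq V) :
  v \in m t :: exchange_walk m t p ->
  exists2 u, u \in t :: p & (v == u) || (v == m u).
Proof.
elim: p t => [|u p IH] t.
  by rewrite !inE orbC => vt; exists t; rewrite ?mem_head.
rewrite exchange_walk_cons in_cons [v \in t :: _]in_cons orbA [_ || (v == t)]orbC.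
case/orP=> [vt|]; first by exists t; rewrite ?mem_head.
by case/IH=> x xp vx; exists x; rewrite // in_cons xp orbT.
Qed.

Lemma exchange_walk_edges (V : finType) (m : V -> V) (t : V) (p : seq V) :
  walk_edges (m t) (exchange_walk m t p) =
    [set:: [seq [set m u; u] | u <- t :: p]]
    :|: [set:: pairmap (fun u u' => [set u; m u']) t p].
Proof.
elim: p t => [|u p IH] t.
  by rewrite walk_edges_cons walk_edges0; apply/setP => e; rewrite !inE.
rewrite exchange_walk_cons walk_edges_cons walk_edges_cons IH.
by apply/setP => e; rewrite !(inE, in_cons); do !case: eqP => //= _; rewrite ?orbT.
Qed.

Lemma exchange_walk_path (V : eqType) (r : rel V) (m : V -> V) (t : V) (p : seq V) :
  {in t :: p, forall u, r (m u) u} -> path (fun u u' => r u (m u')) t p ->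
  path r (m t) (exchange_walk m t p).
Proof.
elim: p t => [|u p IH] t rm; first by rewrite /= rm ?mem_head.
move=> /andP[rtu pu]; rewrite exchange_walk_cons /= rm ?mem_head //= rtu /=.
by apply: IH => // x xp; apply: rm; rewrite in_cons xp orbT.
Qed.

(** The walk has one matched edge per task of [t :: p] and at most [size p] links from a task to the
    partner of the next, whence the strict inequality. It alternates because the links are pairwise
    disjoint: the tasks are distinct and [m] is injective on [B]. *)
Lemma exchange_walkP (V : finType) (A B : {set V}) (M : {set {set V}})
  (m : V -> V) (t : V) (p : seq V) :
  let P := walk_edges (m t) (exchange_walk m t p) in
  [disjoint A & B] -> trivIset M -> {in B, forall u, m u \in A} ->
  {in B, forall u, [set m u; u] \in M} ->
  uniq (t :: p) -> {subset t :: p <= B} ->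
  [/\ uniq (m t :: exchange_walk m t p), alternating M P
    & (#|P :\: M| < #|P :&: M|)%N].
Proof.
move=> P dAB tM mA mM utp tpB.
have mNB u v : u \in B -> v \in B -> m u != v.
  by move=> uB vB; apply: contraTneq vB => <-; rewrite (disjointFr dAB) ?mA.
have edge_inj u v : u \in B -> v \in B -> [set m u; u] = [set m v; v] -> u = v.
  move=> uB vB E; have : u \in [set m v; v] by rewrite -E set22.
  by rewrite !inE [u == m v]eq_sym (negPf (mNB v u vB uB)) => /eqP.
have m_inj u v : u \in B -> v \in B -> m u = m v -> u = v.
  move=> uB vB E; apply: edge_inj => //.
  by apply: (trivIset_eq tM (mM u uB) (mM v vB) (set21 _ _)); rewrite E set21.
have tiD : trivIset [set:: pairmap (fun u u' => [set u; m u']) t p].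
  apply: eq_trivIset => e f v; rewrite !inE.
  case/(nthP set0)=> k; rewrite size_pairmap => kp <-.
  case/(nthP set0)=> l; rewrite size_pairmap => lp <-.
  rewrite !(nth_pairmap t) //.
  have pB h : (h < size p)%N -> nth t p h \in B.
    by move=> hp; apply: tpB; rewrite in_cons mem_nth ?orbT.
  have tB h : (h < size p)%N -> nth t (t :: p) h \in B.
    by move=> hp; apply: tpB; rewrite mem_nth //= ltnW.
  (* A task or an agent shared by two links forces their indices to agree; a task never equals an
     agent. *)
  case/set2P=> -> /set2P[] E.
  - have := @nth_uniq _ t (t :: p) k l (leqW kp) (leqW lp) utp.
    by rewrite E eqxx => /esym/eqP->.
  - by have := mNB _ _ (pB _ lp) (tB _ kp); rewrite E eqxx.
  - by have := mNB _ _ (pB _ kp) (tB _ lp); rewrite E eqxx.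
  - have := @nth_uniq _ t p k l kp lp (proj2 (andP utp)).
    by rewrite (m_inj _ _ (pB _ kp) (pB _ lp) E) eqxx => /esym/eqP->.
have inM : [set:: [seq [set m u; u] | u <- t :: p]] \subset M.
  by apply/subsetP => e; rewrite inE => /mapP[u /tpB uB ->]; apply: mM.
have PD : P :\: M \subset [set:: pairmap (fun u u' => [set u; m u']) t p].
  apply/subsetP => e; rewrite /P exchange_walk_edges => /setDP[/setUP[|//] eM].
  by rewrite (subsetP inM).
have PI : [set:: [seq [set m u; u] | u <- t :: p]] \subset P :&: M.
  by rewrite subsetI inM andbT /P exchange_walk_edges subsetUl.
split.
- elim: p t utp tpB {P tiD inM PD PI} => [|u p IH] t utp tpB.
    by rewrite /= inE mNB // tpB ?mem_head.
  have [tp utp'] := andP utp.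
  have sB : {subset u :: p <= B} by move=> v vp; apply: tpB; rewrite in_cons vp orbT.
  have tB : t \in B by rewrite tpB ?mem_head.
  rewrite exchange_walk_cons cons_uniq [uniq (t :: _)]cons_uniq in_cons.
  rewrite negb_or mNB // (IH u) // andbT.
  apply/andP; split; apply/negP => /mem_exchange_walk[v vp].
    case/orP=> /eqP E; first by have := mNB t v tB (sB v vp); rewrite E eqxx.
    by move: tp; rewrite (m_inj _ _ tB (sB v vp) E) vp.
  case/orP=> /eqP E; first by move: tp; rewrite E vp.
  by have := mNB v t (sB v vp) tB; rewrite E eqxx.
- exact/trivIset_alternating/(trivIsetS PD).
- have le1 := subset_leq_card PI; apply: leq_trans le1.
  rewrite card_set_seq; last first.
    by rewrite map_inj_in_uniq // => u v /tpB uB /tpB vB; apply: edge_inj.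
  rewrite size_map /= ltnS; apply: leq_trans (subset_leq_card PD) _.
  by rewrite cardsE; apply: leq_trans (card_size _) _; rewrite size_pairmap.
Qed.

(* Otherwise the tasks of X together with the tasks of B2 reachable from X would
   have fewer light neighbours than elements, against the matching M3. *)
Lemma exchange_path (R : realType) (V : finType) (A1 A2 B1 B2 X Y : {set V})
  (w : {set V} -> R) (W : R) (M2 M3 : {set {set V}}) :
  let G1 := complete_bipartite A1 B1 in
  let G2 := complete_bipartite A2 B2 in
  let G3 := complete_bipartite (A1 :|: A2) (B1 :|: B2) in
  [disjoint B1 & B2] -> [disjoint A1 :|: A2 & B1 :|: B2] ->
  M2 \subset edges G2 -> trivIset M2 -> (forall f, f \in M2 -> w f < W) ->
  vertices G2 \subset cover M2 ->
  M3 \subset edges G3 -> trivIset M3 -> (forall f, f \in M3 -> w f < W) ->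
  B1 :|: B2 \subset cover M3 ->
  A1 \subset X :|: Y -> [disjoint X & Y] ->
  (forall f, f \in edges G1 -> w f < W -> f \subset X \/ f \subset Y) ->
  (#|X :&: A1| < #|X :&: B1|)%N ->
  exists i j : V,
    [/\ i \in A2, j \in B2,
        exists b', [/\ b' \in X :&: B1,
                       [set i; b'] \in edges G3 & w [set i; b'] < W],
        exists a', [/\ a' \in Y :&: A1,
                       [set j; a'] \in edges G3 & w [set j; a'] < W]
      & exists P : {set {set V}}, [/\ is_path G3 i j P, alternating M2 P,
                      forall e, e \in P -> w e < W
                    & (#|P :\: M2| < #|P :&: M2|)%N]].
Proof.
move=> G1 G2 G3 dB dAB sM2 tM2 wM2 cM2 sM3 tM3 wM3 cM3 sA1 dXY clX ltX.
have dAB2 : [disjoint A2 & B2].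
  by apply: disjointWl (subsetUr A1 A2) _; apply: disjointWr (subsetUr B1 B2) _.
(* The agent that [M2] assigns to [t]. The default is never reached on [B2], whose tasks are all
   matched. *)
pose m t := odflt t [pick a in A2 | [set a; t] \in M2].
have mP t : t \in B2 -> (m t \in A2) /\ ([set m t; t] \in M2).
  move=> tB; rewrite /m; case: pickP => [a /andP[]//|no_a].
  have /coverP[e eM te] : t \in cover M2 by apply: (subsetP cM2); rewrite inE tB orbT.
  have /complete_bipartiteP[a [b [aA bB eE]]] := subsetP sM2 e eM.
  have tb : t = b.
    by move: te; rewrite eE => /set2P[] // ta; rewrite -ta (disjointFl dAB2 tB) in aA.
  by have /negP[] := no_a a; rewrite aA tb -eE.
have m_onto a : a \in A2 -> exists2 t, t \in B2 & a = m t.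
  move=> aA; have /coverP[e eM ae] : a \in cover M2.
    by apply: (subsetP cM2); rewrite inE aA.
  have /complete_bipartiteP[a' [t [a'A tB eE]]] := subsetP sM2 e eM.
  exists t => //; have [mA mM] := mP t tB.
  have te : t \in e by rewrite eE set22.
  have : a \in [set m t; t] by rewrite -(trivIset_eq tM2 eM mM te (set22 _ _)).
  by case/set2P=> // aT; rewrite aT (disjointFl dAB2 tB) in aA.
have in3 a b : a \in A1 :|: A2 -> b \in B1 :|: B2 -> [set a; b] \in edges G3.
  exact: complete_bipartite_edge.
(* The exchange digraph on [B2]: an arc from [t] to [u] means that a light edge joins [t] to the
   agent of [u]. At an [entry] the agent of the task is lightly adjacent to a task of [X]; an [exit]
   is lightly adjacent to an agent of [Y]. *)
pose r t u := [&& t \in B2, u \in B2 & w [set t; m u] < W].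
pose entry t := (t \in B2) && [exists b in X :&: B1, w [set m t; b] < W].
pose exit t := (t \in B2) && [exists a in Y :&: A1, w [set t; a] < W].
have [/existsP[t0 /existsP[j /and3P[ent /connectP[p0 p0r ->] exi]]]|noex] :=
  boolP [exists t, exists u, [&& entry t, connect r t u & exit u]].
  (* An entry [t0] reaches an exit. A simple path between them yields the exchange walk from [m t0]
     to that exit, whose edge set serves as [P]. *)
  move: exi; case: (shortenP p0r) => p pr up _ exi {p0 p0r}.
  have [t0B /existsP[b /andP[bX wb]]] := andP ent.
  have [lB /existsP[a /andP[aY wa]]] := andP exi.
  have sB : {subset t0 :: p <= B2}.
    elim: p t0 pr t0B {up lB ent exi b bX wb a aY wa} => [|u p IH] t pr tB v.
      by rewrite inE => /eqP->.
    have [/and3P[_ uB _] pr'] := andP pr.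
    by rewrite in_cons => /predU1P[->//|]; apply: IH.
  have mA : {in B2, forall u, m u \in A2} by move=> u /mP[].
  have mM : {in B2, forall u, [set m u; u] \in M2} by move=> u /mP[].
  have [us alt ltP] := exchange_walkP dAB2 tM2 mA mM up sB.
  have inA2 u : u \in A2 -> u \in A1 :|: A2 by rewrite inE => ->; rewrite orbT.
  have inB2 u : u \in B2 -> u \in B1 :|: B2 by rewrite inE => ->; rewrite orbT.
  exists (m t0), (last t0 p); split=> //; first exact: mA.
  - exists b; split=> //; apply: in3; first by rewrite inA2 ?mA.
    by move: bX; rewrite !inE => /andP[_ ->].
  - exists a; split=> //; rewrite setUC; apply: in3; last exact: inB2.
    by move: aY; rewrite !inE => /andP[_ ->].
  exists (walk_edges (m t0) (exchange_walk m t0 p)); split=> //.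
    exists (exchange_walk m t0 p); split=> //.
    - move=> v /mem_exchange_walk[u /sB uB /orP[]/eqP->].
        by rewrite inE inB2 ?orbT.
      by rewrite inE inA2 ?mA.
    - apply: exchange_walk_path => [u /sB uB|].
        by apply: in3; [apply/inA2/mA|apply: inB2].
      apply: sub_path pr => u v /and3P[uB vB _]; rewrite setUC.
      by apply: in3; [apply/inA2/mA|apply: inB2].
    - by rewrite last_exchange_walk.
  move=> e; rewrite exchange_walk_edges => /setUP[]; rewrite inE.
    by case/mapP=> u /sB uB ->; apply/wM2/mM.
  elim: p t0 pr {ent up exi t0B b bX wb lB a aY wa sB us alt ltP} => //= u p IH t.
  by case/andP=> /and3P[_ _ wtu] /IH IHu; rewrite in_cons => /predU1P[->|].
(* No entry reaches an exit. [S] holds the tasks reachable from entries, [S'] adds the tasks of [X],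
   and [M'] is the part of [M3] serving them. *)
pose S := [set t in B2 | [exists t0, entry t0 && connect r t0 t]].
pose S' := S :|: (X :&: B1).
pose M' := [set e in M3 | ~~ [disjoint e & S']].
have sS' : S' \subset B1 :|: B2.
  by apply/subsetP => v; rewrite !inE => /orP[/andP[-> _]|/andP[_ ->]]; rewrite ?orbT.
have sM' : M' \subset M3 by apply/subsetP => e; rewrite inE => /andP[].
have tM' := trivIsetS sM' tM3; have sM'3 := subset_trans sM' sM3.
have edgeM' e : e \in M' -> exists a b,
    [/\ a \in A1 :|: A2, b \in S', e = [set a; b] & w e < W].
  rewrite inE => /andP[eM /pred0Pn[v /= /andP[ve vS]]].
  have /complete_bipartiteP[a [b [aA bB eE]]] := subsetP sM3 e eM.
  exists a, b; split=> //; last exact: wM3.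
  move: ve; rewrite eE => /set2P[va|<-//].
  by have := subsetP sS' v vS; rewrite va (disjointFr dAB aA).
(* [M3] covers all tasks and each of its edges contains a single task, so [M'] has one edge per
   element of [S']. *)
have cS : #|S'| = #|M'|.
  rewrite -[RHS]muln1 -(@card_cover_meet _ M' S' 1) //.
    congr #|pred_of_set _|; apply/esym/setIidPr/subsetP => v vS.
    have /coverP[e eM ve] := subsetP cM3 v (subsetP sS' v vS).
    apply: (mem_cover _ ve); rewrite inE eM; apply/pred0Pn; exists v => /=.
    by rewrite ve vS.
  move=> e /edgeM'[a [b [aA bS -> _]]]; apply/eqP/cards1P; exists b.
  apply/setP => v; rewrite in_setI !(in_set1, in_set2).
  have [->|_] := eqVneq v b; first by rewrite orbT bS.
  rewrite orbF; apply/andP => -[/eqP-> aS].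
  by have := subsetP sS' a aS; rewrite (disjointFr dAB aA).
(* An agent of [M'] in [A1] must lie in [X], otherwise it would give a reachable exit or a light
   edge from [X] to [Y]; one in [A2] is the partner of a task that is again reachable. *)
have sN : cover M' :&: (A1 :|: A2) \subset (X :&: A1) :|: [set m t | t in S].
  apply/subsetP => v /setIP[/coverP[e /edgeM'[a [b [aA bS eE we]]] ve] vA].
  have va : v = a.
    move: ve; rewrite eE => /set2P[] // vb.
    by have := subsetP sS' b bS; rewrite -vb (disjointFr dAB vA).
  rewrite {v vA ve}va in_setU; rewrite eE in we.
  case/setUP: aA => [aA1|aA2].
    have aX : a \in X.
      case/setUP: bS => [bS|/setIP[bX bB1]].
        have /setUP[//|aY] := subsetP sA1 a aA1.
        move: bS; rewrite inE => /andP[bB /existsP[t0 /andP[ent con]]].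
        case/negP: noex; apply/existsP; exists t0; apply/existsP; exists b.
        rewrite ent con /exit bB; apply/existsP; exists a.
        by rewrite inE aY aA1 setUC.
      have [|/subsetP sub|/subsetP sub] := clX [set a; b] _ we.
      - exact: complete_bipartite_edge.
      - by apply: sub; rewrite set21.
      - by have := sub b (set22 _ _); rewrite (disjointFr dXY bX).
    by rewrite inE aX aA1.
  have [t tB aE] := m_onto a aA2; apply/orP; right; rewrite aE.
  apply: imset_f; rewrite inE tB /=.
  case/setUP: bS => [|bX].
    rewrite inE => /andP[bB /existsP[t0 /andP[ent con]]].
    apply/existsP; exists t0; rewrite ent; apply: connect_trans con _.
    by apply: connect1; rewrite /r bB tB -aE setUC.
  apply/existsP; exists t; rewrite connect0 andbT /entry tB.
  by apply/existsP; exists b; rewrite bX -aE.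
(* The contradiction: [M'] has [#|S| + #|X :&: B1|] agents, while at most [#|X :&: A1| + #|S|] are
   available. *)
have := subset_leq_card sN.
rewrite (card_matching_agents dAB sM'3 tM') -cS leqNgt => /negP[].
have -> : #|S'| = (#|S| + #|X :&: B1|)%N.
  rewrite cardsU; suff -> : S :&: (X :&: B1) = set0 by rewrite cards0 subn0.
  apply/setP => v; rewrite !inE; apply/negP => /andP[/andP[vB _] /andP[_ vB1]].
  by rewrite (disjointFr dB vB1) in vB.
have lU := (leq_card_setU (X :&: A1) [set m t | t in S]).1.
apply: leq_ltn_trans lU _; rewrite -addSn addnC leq_add //.
exact: leq_imset_card.
Qed.

(** * The split by the two trees, and the assembly of a light matching *)

(** Each edge of the pruned set other than [e] belongs to one of the trees, and a simple graph keeps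
    its edges inside its vertex set, so none crosses between [X] and [Y]. *)
Lemma agent_task_treesP (R : realType) (V : finType) (A B : {set V})
  (w : {set V} -> R) (M : {set {set V}}) (e : {set V}) (Tmu Tnu : graph V) :
  let X := vertices Tnu in let Y := vertices Tmu in
  agent_task_trees A B w M e Tmu Tnu ->
  [/\ A :|: B = X :|: Y, [disjoint X & Y],
      forall f, f \in pruned (complete_bipartite A B) w M :\ e ->
        f \subset X \/ f \subset Y
    & exists a b, [/\ a \in A :&: Y, b \in B :&: X & e = [set a; b]]].
Proof.
move=> X Y [[rm [[Tm _ _] _]] [rn [[Tn _ _] _]] [EE _] [VV V0] [a [b [aA bB eE aY bX]]]].
split.
- by apply/esym; rewrite setUC; apply: VV.
- by rewrite -setI_eq0 setIC V0.
- by move=> f; rewrite -EE => /setUP[/Tm[]|/Tn[]]; [right|left].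
- by exists a, b; rewrite !inE aA bB aY bX.
Qed.

(* One vertex is unmatched by M :\ e in X, and it is a task. *)
Lemma cluster_card_lt (V : finType) (A B X Y : {set V})
  (M : {set {set V}}) (e : {set V}) (a b : V) :
  [disjoint A & B] -> M \subset edges (complete_bipartite A B) -> trivIset M ->
  A \subset cover M -> [disjoint X & Y] -> e = [set a; b] -> e \in M ->
  a \in Y -> b \in B :&: X ->
  (forall f, f \in M :\ e -> f \subset X \/ f \subset Y) ->
  (#|X :&: A| < #|X :&: B|)%N.
Proof.
move=> dAB sM tM AM dXY eE eM aY /setIP[bB bX] clX.
(* [N] reaches every agent of [X], because [e] meets [X] only in the task [b], but it leaves [b]
   uncovered. *)
pose N := [set f in M :\ e | f \subset X].
have sN : N \subset M.
  by apply/subsetP => f; rewrite inE => /andP[/setD1P[]].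
have tN := trivIsetS sN tM; have sNG := subset_trans sN sM.
have NX : cover N \subset X.
  by apply/bigcupsP => f; rewrite inE => /andP[].
have leA : (#|X :&: A| <= #|N|)%N.
  rewrite -(card_matching_agents dAB sNG tN); apply: subset_leq_card.
  apply/subsetP => v /setIP[vX vA]; rewrite inE vA andbT.
  have /coverP[f fM vf] := subsetP AM v vA.
  have fe : f != e.
    apply: contraTneq vA => fe; move: vf; rewrite fe eE => /set2P[] vE.
      by rewrite vE (disjointFl dXY aY) in vX.
    by rewrite vE (disjointFl dAB bB).
  have fD : f \in M :\ e by rewrite in_setD1 fe.
  apply: (mem_cover _ vf); rewrite inE fD.
  case: (clX f fD) => // /subsetP fY.
  by rewrite (disjointFl dXY (fY v vf)) in vX.
apply: leq_ltn_trans leA _; rewrite -(card_matching_side dAB sNG tN).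
apply: proper_card; apply/properP; split; first exact: setSI.
exists b; rewrite inE ?bX // negb_and; apply/orP; left.
apply/negP => /coverP[f]; rewrite inE => /andP[/setD1P[/eqP fe fM] _] bf.
by case: fe; apply: (trivIset_eq tM fM eM bf); rewrite eE set22.
Qed.

(* The three swapped matchings live on the disjoint vertex sets X, Y and
   A2 :|: B2, and leave b', a' and the ends of the path to be joined. *)
Lemma light_matching (R : realType) (V : finType) (A1 A2 B1 B2 X Y : {set V})
  (w : {set V} -> R) (W : R) (M1 M2 P : {set {set V}}) (e : {set V})
  (a b i j a' b' : V) :
  let G1 := complete_bipartite A1 B1 in
  let G2 := complete_bipartite A2 B2 in
  let G3 := complete_bipartite (A1 :|: A2) (B1 :|: B2) in
  [disjoint A1 & A2] -> [disjoint B1 & B2] -> [disjoint A1 :|: A2 & B1 :|: B2] ->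
  trivIset M1 -> e \in M1 -> bottleneck_cluster G1 w M1 e ->
  (forall f, f \in pruned G1 w M1 :\ e -> (f \in edges G1) && (w f < W)) ->
  A1 :|: B1 = X :|: Y -> [disjoint X & Y] ->
  (forall f, f \in pruned G1 w M1 :\ e -> f \subset X \/ f \subset Y) ->
  a \in A1 :&: Y -> b \in B1 :&: X -> e = [set a; b] ->
  M2 \subset edges G2 -> trivIset M2 -> (forall f, f \in M2 -> w f < W) ->
  i \in A2 -> j \in B2 -> b' \in X :&: B1 -> w [set i; b'] < W ->
  a' \in Y :&: A1 -> w [set j; a'] < W ->
  is_path G3 i j P -> alternating M2 P -> (forall f, f \in P -> w f < W) ->
  (#|P :\: M2| < #|P :&: M2|)%N ->
  exists N : {set {set V}}, [/\ N \subset edges G3, trivIset N, forall f, f \in N -> w f < W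
    & #|N| = (#|M1| + #|M2|)%N].
Proof.
move=> G1 G2 G3 dA dB dAB tM1 eM1 clu prW XY dXY clXY /setIP[aA aY] /setIP[bB bX] eE
  sM2 tM2 wM2 iA jB /setIP[bX' bB'] wib /setIP[aY' aA'] wja [s [_ us sG ps [ls PE]]]
  alt wP ltP.
have s13 : edges G1 \subset edges G3 by apply: complete_bipartiteS; apply: subsetUl.
have s23 : edges G2 \subset edges G3 by apply: complete_bipartiteS; apply: subsetUr.
have dAB1 : [disjoint A1 & B1].
  by apply: disjointWl (subsetUl A1 A2) _; apply: disjointWr (subsetUl B1 B2) _.
pose Z := A2 :|: B2.
have dXYZ : [disjoint X :|: Y & Z].
  rewrite -XY; apply/pred0P => v /=; rewrite !inE; apply/negP.
  case/andP=> /orP[]v1 /orP[]v2.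
  - by rewrite (disjointFr dA v1) in v2.
  - by have := @disjointFr _ _ _ v dAB; rewrite !inE v1 v2 ?orbT => /(_ isT).
  - by have := @disjointFl _ _ _ v dAB; rewrite !inE v1 v2 ?orbT => /(_ isT).
  - by rewrite (disjointFr dB v1) in v2.
have dXZ : [disjoint X & Z] by apply: disjointWl dXYZ; apply: subsetUl.
have dYZ : [disjoint Y & Z] by apply: disjointWl dXYZ; apply: subsetUr.
have iZ : i \in Z by rewrite inE iA.
have jZ : j \in Z by rewrite inE jB orbT.
have eX : e :&: X = [set b].
  apply/setP => v; rewrite eE !inE; case: (eqVneq v b) => [->|_]; first by rewrite orbT bX.
  by rewrite orbF; apply/andP => -[/eqP->]; rewrite (disjointFl dXY aY).
have eY : e :&: Y = [set a].
  apply/setP => v; rewrite eE !inE; case: (eqVneq v a) => [->|_]; first by rewrite aY.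
  by apply/andP => -[/eqP->]; rewrite (disjointFr dXY bX).
have clX f : f \in pruned G1 w M1 :\ e -> f \subset X \/ [disjoint f & X].
  move/clXY => [fX|fY]; [by left|right].
  by apply: disjointWl fY _; rewrite disjoint_sym.
have clY f : f \in pruned G1 w M1 :\ e -> f \subset Y \/ [disjoint f & Y].
  by move/clXY => [fX|fY]; [right; apply: disjointWl fX _|left].
have [|//|NX [sNX tNX cNX bNX kNX]] := cluster_swap dAB1 tM1 eM1 clu clX eX bX'.
- by rewrite inE bB' orbT.
- by rewrite bB bB'.
have [||NY [sNY tNY cNY aNY kNY]] := cluster_swap dAB1 tM1 eM1 clu clY eY aY'.
- by rewrite inE aA'.
- by rewrite (disjointFr dAB1 aA) (disjointFr dAB1 aA').
have tPM : trivIset (P :\: M2) by apply: alternating_trivIset.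
rewrite PE in ltP tPM.
have [tNZ kNZ iNZ jNZ cNZ] := swap_odd_walk tM2 us tPM ltP.
rewrite -PE ls in tNZ kNZ iNZ jNZ cNZ; have sNZ := swap_sub M2 P.
move: (swap M2 P) => NZ in tNZ kNZ iNZ jNZ cNZ sNZ.
have {}cNZ : cover NZ \subset Z.
  apply: subset_trans cNZ _; apply/bigcupsP => f /(subsetP sM2).
  exact: complete_bipartite_sub.
(* Edges are nonempty, as each contains a task; this lets the cardinalities of the pieces add up. *)
have n0 (K : {set {set V}}) : K \subset pruned G1 w M1 :\ e -> set0 \notin K.
  move=> sK; apply/negP => /(subsetP sK)/prW/andP[/(card_edge_side dAB1)].
  by rewrite set0I cards0.
(* [M1 :\ e] splits into its edges inside [X] and those inside [Y], and each swap preserves the size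
   of its part. *)
have card1 : (#|NX| + #|NY|).+1 = #|M1|.
  rewrite kNX kNY [RHS](cardsD1 e) eM1 add1n; congr _.+1.
  have sD (K : {set V}) : [set f in M1 :\ e | f \subset K] \subset M1 :\ e.
    by apply/subsetP => f; rewrite inE => /andP[].
  have cD (K : {set V}) : cover [set f in M1 :\ e | f \subset K] \subset K.
    by apply/bigcupsP => f; rewrite inE => /andP[].
  have tD := trivIsetD [set e] tM1.
  have sMp : M1 :\ e \subset pruned G1 w M1 :\ e by apply: setSD; apply: subsetUl.
  have [_ <-] := trivIset_disjointU (trivIsetS (sD X) tD) (trivIsetS (sD Y) tD)
    (n0 _ (subset_trans (sD X) sMp)) (disjointW (cD X) (cD Y) dXY).
  congr #|pred_of_set _|; apply/setP => f; rewrite in_setU 2!in_set.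
  have [fM|//] := boolP (f \in M1 :\ e); rewrite /=.
  by case: (clXY f (subsetP sMp f fM)) => ->; rewrite ?orbT.
have notin (K K' : {set V}) (N : {set {set V}}) v :
    [disjoint K & K'] -> cover N \subset K' -> v \in K -> v \notin cover N.
  move=> dK /subsetP cN vK; apply/negP => /cN.
  by rewrite (disjointFr dK vK).
have notin' (K K' : {set V}) (N : {set {set V}}) v :
    [disjoint K' & K] -> cover N \subset K' -> v \in K -> v \notin cover N.
  by rewrite disjoint_sym; apply: notin.
have neq (K K' : {set V}) u v : [disjoint K & K'] -> u \in K -> v \in K' -> u != v.
  by move=> dK uK vK; apply: contraTneq vK => <-; rewrite (disjointFr dK uK).
have [t1 k1] := trivIset_disjointU tNX tNY (n0 _ sNX) (disjointW cNX cNY dXY).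
have c1 : cover (NX :|: NY) \subset X :|: Y by rewrite coverU setUSS.
have [|t2 k2] := trivIset_disjointU t1 tNZ _ (disjointW c1 cNZ dXYZ).
  by rewrite inE negb_or !n0.
have [||t3 k3 c3] := trivIset_add_edge (u := i) (v := b') t2.
- by rewrite !coverU !inE !negb_or iNZ (notin' _ _ _ _ dXZ) ?(notin' _ _ _ _ dYZ).
- by rewrite !coverU !inE !negb_or bNX (notin _ _ _ _ dXY) ?(notin _ _ _ _ dXZ).
have ji : j != i.
  by rewrite eq_sym (neq _ _ _ _ dAB) // inE ?iA ?jB orbT.
have jb : j != b' by rewrite eq_sym (neq _ _ _ _ dXZ).
have ai : a' != i by rewrite (neq _ _ _ _ dYZ).
have ab : a' != b' by rewrite eq_sym (neq _ _ _ _ dXY).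
have [||t4 k4 _] := trivIset_add_edge (u := j) (v := a') t3.
- by rewrite c3 !coverU !inE !negb_or jNZ ji jb (notin' _ _ _ _ dXZ) ?(notin' _ _ _ _ dYZ).
- by rewrite c3 !coverU !inE !negb_or aNY ai ab (notin' _ _ _ _ dXY) ?(notin _ _ _ _ dYZ).
(* The two joining edges make up for two losses: the deleted [e], and the one edge by which swapping
   along [P] shrinks [M2]. *)
exists ([set j; a'] |: ([set i; b'] |: (NX :|: NY :|: NZ))).
have good f : f \in [set j; a'] |: ([set i; b'] |: (NX :|: NY :|: NZ)) ->
    (f \in edges G3) && (w f < W).
  have prW3 g : g \in pruned G1 w M1 :\ e -> (g \in edges G3) && (w g < W).
    by case/prW/andP=> /(subsetP s13)-> ->.
  have M2W g : g \in M2 -> (g \in edges G3) && (w g < W).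
    by move=> gM; rewrite (subsetP s23) ?(subsetP sM2) ?wM2.
  have PW g : g \in P -> (g \in edges G3) && (w g < W).
    move=> gP; rewrite wP // andbT; move: gP ps; rewrite PE.
    elim: (s) (i) => [|y s' IH] x; first by rewrite walk_edges0 inE.
    rewrite walk_edges_cons /= => /setU1P[->|gs'] /andP[xy pys] //.
    exact: IH gs' pys.
  case/setU1P=> [->|/setU1P[->|/setUP[/setUP[|]|]]].
  - by rewrite wja andbT setUC complete_bipartite_edge // inE ?aA' ?jB ?orbT.
  - by rewrite wib andbT complete_bipartite_edge // inE ?bB' ?iA ?orbT.
  - by move/(subsetP sNX); apply: prW3.
  - by move/(subsetP sNY); apply: prW3.
  - by move/(subsetP sNZ)/setUP => [/M2W|/PW].
split=> //.
- by apply/subsetP => f /good/andP[].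
- by move=> f /good/andP[].
- by rewrite k4 k3 k2 k1 -card1 -kNZ addSn addnS.
Qed.

(** * Comparing the bottleneck of the merged graph with [w e1] *)

Theorem theorem2 (R : realType) (V : finType) (A1 A2 B1 B2 : {set V})
    (w : {set V} -> R) (M1 M2 : {set {set V}}) (e1 e2 e3 : {set V})
    (Tmu1 Tnu1 : graph V)
    (disjA : [disjoint A1 & A2]) (disjB : [disjoint B1 & B2])
    (disjAB : [disjoint A1 :|: A2 & B1 :|: B2])
    (B1_gt0 : (1 <= #|B1|)%N) (leBA1 : (#|B1| <= #|A1|)%N)
    (B2_gt0 : (1 <= #|B2|)%N) (leBA2 : (#|B2| <= #|A2|)%N) :
  let G1 := complete_bipartite A1 B1 in
  let G2 := complete_bipartite A2 B2 in
  let G3 := complete_bipartite (A1 :|: A2) (B1 :|: B2) in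
  bottleneck_assignment G1 w M1 ->
  bottleneck_assignment G2 w M2 ->
  critical_bottleneck_edge G1 w M1 e1 ->
  critical_bottleneck_edge G2 w M2 e2 ->
  bottleneck_cluster G1 w M1 e1 ->
  bottleneck_cluster G2 w M2 e2 ->
  agent_task_trees A1 B1 w M1 e1 Tmu1 Tnu1 ->
  bottleneck_edge G3 w e3 ->
  w e2 < w e1 ->
  #|argmax w M1| = 1%N ->
  w e3 < w e1 <->
  exists i j : V,
    [/\ i \in A2, j \in B2,
        exists b', [/\ b' \in vertices Tnu1 :&: B1,
                       [set i; b'] \in edges G3 & w [set i; b'] < w e1],
        exists a', [/\ a' \in vertices Tmu1 :&: A1,
                       [set j; a'] \in edges G3 & w [set j; a'] < w e1]
      & exists P : {set {set V}}, [/\ is_path G3 i j P, alternating M2 P,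
                      forall e, e \in P -> w e < w e1
                    & (#|P :\: M2| < #|P :&: M2|)%N]].
Proof.
move=> G1 G2 G3 [[[sM1 tM1] maxM1] _] [[[sM2 tM2] maxM2] _] crit1 crit2 clu1 clu2 trees
  [M3 [[mcm3 min3] e3M]] lt21 arg1.
have mcm1 : mcm G1 M1 by [].
have mcm2 : mcm G2 M2 by [].
have dAB1 : [disjoint A1 & B1].
  by apply: disjointWl (subsetUl A1 A2) _; apply: disjointWr (subsetUl B1 B2) _.
have dAB2 : [disjoint A2 & B2].
  by apply: disjointWl (subsetUr A1 A2) _; apply: disjointWr (subsetUr B1 B2) _.
have [XY dXY clXY [a [b [aY bX eE]]]] := agent_task_treesP trees.
have [e1a _] := crit1; have [e2a _] := crit2.
have argE : argmax w M1 = [set e1].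
  by apply/esym/eqP; rewrite eqEcard sub1set e1a arg1 cards1.
have [e1M /eqP we1] : e1 \in M1 /\ w e1 == wmax w M1.
  by move: e1a; rewrite inE => /andP[].
have wM2 f : f \in M2 -> w f < w e1.
  move=> fM; apply: le_lt_trans lt21.
  by move: e2a; rewrite inE => /andP[_ /eqP->]; apply: wmax_ge.
have prE f : (f \in pruned G1 w M1 :\ e1) = (f \in edges G1) && (w f < w e1).
  by rewrite we1; apply: pruned_setD1.
have we3 : w e3 = wmax w M3 by move: e3M; rewrite inE => /andP[_ /eqP].
have cA : #|A1 :|: A2| = (#|A1| + #|A2|)%N.
  by rewrite cardsU disjoint_setI0 // cards0 subn0.
have cB : #|B1 :|: B2| = (#|B1| + #|B2|)%N.
  by rewrite cardsU disjoint_setI0 // cards0 subn0.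
split=> [lt31|[i [j [iA jB [b' [bX' _ wb]] [a' [aY' _ wa]] [P [pP alt wP ltP]]]]]].
  (* [e3] is a heaviest edge of [M3], so all of [M3] is lighter than [w e1]; having as many edges as
     there are tasks, [M3] covers every task. *)
  have [[sM3 tM3] _] := mcm3.
  have card3 : #|M3| = #|B1 :|: B2| by apply: card_mcm mcm3; rewrite // cA cB leq_add.
  apply: (exchange_path (W := w e1) (M2 := M2) (M3 := M3) disjB disjAB _ _ wM2 _ sM3 tM3
    _ _ _ dXY) => //.
  - exact: critical_cluster_covers tM2 crit2 clu2.
  - by move=> f fM; apply: le_lt_trans lt31; rewrite we3 wmax_ge.
  - apply/setIidPr/eqP; rewrite eqEcard subsetIr /=.
    by rewrite (card_matching_side disjAB sM3 tM3) card3.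
  - by rewrite -XY subsetUl.
  - by move=> f fG wf; apply: clXY; rewrite prE fG.
  - have aTmu : a \in vertices Tmu1 by case/setIP: aY.
    apply: (cluster_card_lt dAB1 sM1 tM1 _ dXY eE e1M aTmu bX) => [|f fD].
    + apply: subset_trans (critical_cluster_covers tM1 crit1 clu1); exact: subsetUl.
    + by apply: clXY; apply: (subsetP (setSD _ (subsetUl _ _)) f fD).
have prW f : f \in pruned G1 w M1 :\ e1 -> (f \in edges G1) && (w f < w e1) by rewrite prE.
have [N [sN tN wN kN]] := light_matching disjA disjB disjAB tM1 e1M clu1 prW XY dXY
  clXY aY bX eE sM2 tM2 wM2 iA jB bX' wb aY' wa pP alt wP ltP.
(* [N] has one edge for each task of [G3], so it competes with [M3] and its maximum bounds [w e3]
   from above. *)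
have mN : mcm G3 N.
  apply: mcm_of_card => //; rewrite kN cB.
  by rewrite (card_mcm dAB1 leBA1 mcm1) (card_mcm dAB2 leBA2 mcm2).
rewrite we3; apply: le_lt_trans (min3 N mN) _; apply: wmax_lt => //.
(* Nonemptiness matters here because [wmax] takes a default value on the empty set. *)
rewrite -card_gt0 kN addn_gt0; apply/orP; left.
by apply/card_gt0P; exists e1.
Qed.
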